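(* There exists a non-Hausdorff, étale groupoid $\mathcal{G}$ such that $C_0(\mathcal{G}^{(0)})$ is the image of a faithful conditional expectation defined on $C^*_{\mathrm{r}}(\mathcal{G})$.
   Context: An étale groupoid is a topological groupoid $\mathcal{G}$ (not necessarily Hausdorff, continuous multiplication and inversion) whose unit space $\mathcal{G}^{(0)}$ is locally compact and Hausdorff in the relative topology and whose range and source maps $\mathrm{r},\mathrm{d}\colon\mathcal{G}\to\mathcal{G}^{(0)}$ are local homeomorphisms. $C_c(\mathcal{G})$ denotes the space of finite sums of functions $f\colon\mathcal{G}\to\mathbb{C}$, each continuous and compactly supported on some open Hausdorff subset of $\mathcal{G}$ and extended by zero outside it; it is a $*$-algebra under convolution $(f*g)(\gamma)=\sum_{\gamma_1\gamma_2=\gamma}f(\gamma_1)g(\gamma_2)$ and $f^*(\gamma)=\overline{f(\gamma^{-1})}$. For $x\in\mathcal{G}^{(0)}$ let $\pi_x$ be the representation of $C_c(\mathcal{G})$ on $\ell^2(\mathrm{d}^{-1}(x))$ given by $(\pi_x(f)\xi)(\gamma)=\sum_{\gamma_1\gamma_2=\gamma}f(\gamma_1)\xi(\gamma_2)$. $C^*_{\mathrm{r}}(\mathcal{G})$ is the completion of $C_c(\mathcal{G})$ in the norm $\|f\|_r=\sup_{x\in\mathcal{G}^{(0)}}\|\pi_x(f)\|$. $C_0(\mathcal{G}^{(0)})$ is viewed as a $C^*$-subalgebra of $C^*_{\mathrm{r}}(\mathcal{G})$ by extending functions by zero outside the open subset $\mathcal{G}^{(0)}$. *)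

(* Defs.v *)
From HB Require Import structures.
From mathcomp Require Import all_boot all_order all_algebra.
From mathcomp Require Import complex.
From mathcomp Require Import all_classical all_reals all_analysis.

Set Implicit Arguments.
Unset Strict Implicit.
Unset Printing Implicit Defensive.

Import Order.TTheory GRing.Theory Num.Theory.
Import numFieldNormedType.Exports.

Local Open Scope classical_set_scope.
Local Open Scope ring_scope.

(* R[i], typed so that the library's topology on numeric fields applies to it *)
Definition CC (R : realType) : numClosedFieldType := R[i]%C.

(* The real modulus; the library norm `|z| of z : CC R is itself in CC R. *)
Definition modulus (R : realType) (z : CC R) : R := Normc.normc (z : R[i]%C).

(* gmul is total, but gmul g h is only meaningful when src g = rng h. The type
   (set_type units) carries the relative topology. *)
Record topological_groupoid := TopologicalGroupoid {
  arrows :> topologicalType;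
  units : set arrows;
  src : arrows -> set_type units;
  rng : arrows -> set_type units;
  gmul : arrows -> arrows -> arrows;
  ginv : arrows -> arrows;
  src_unit : forall u : set_type units, src (val u) = u;
  rng_unit : forall u : set_type units, rng (val u) = u;
  src_mul : forall g h, src g = rng h -> src (gmul g h) = src h;
  rng_mul : forall g h, src g = rng h -> rng (gmul g h) = rng g;
  gmulA : forall g h k, src g = rng h -> src h = rng k ->
    gmul g (gmul h k) = gmul (gmul g h) k;
  mul_unitl : forall g, gmul (val (rng g)) g = g;
  mul_unitr : forall g, gmul g (val (src g)) = g;
  src_inv : forall g, src (ginv g) = rng g;
  rng_inv : forall g, rng (ginv g) = src g;
  mul_invl : forall g, gmul (ginv g) g = val (src g);
  mul_invr : forall g, gmul g (ginv g) = val (rng g);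
  gmul_continuous : {within [set p : arrows * arrows | src p.1 = rng p.2],
    continuous (fun p : arrows * arrows => gmul p.1 p.2)};
  ginv_continuous : continuous ginv
}.

Arguments units : clear implicits.

Definition local_homeomorphism (S T : topologicalType) (f : S -> T) :=
  forall x : S, exists U : set S,
    [/\ open U, U x, {in U &, injective f}, {within U, continuous f} &
        forall V : set S, open V -> V `<=` U -> open (f @` V)].

Definition etale (G : topological_groupoid) :=
  [/\ hausdorff_space (set_type (units G)),
      locally_compact [set: set_type (units G)],
      local_homeomorphism (@src G) &
      local_homeomorphism (@rng G)].

Section groupoid_functions.
Variables (R : realType) (G : topological_groupoid).

(* Functions that are continuous and compactly supported on U, extended by zero
   to G. As G need not be Hausdorff, the support is the closure relative to U. *)
Definition Cc_on (U : set G) : set (G -> CC R) :=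
  [set f | [/\ {within U, continuous f}, (forall g, ~ U g -> f g = 0) &
               compact (U `&` closure [set g | f g != 0])]].

Definition Cc : set (G -> CC R) :=
  [set f | exists (n : nat) (F : 'I_n -> G -> CC R),
     (forall i, exists U : set G,
        [/\ open U, hausdorff_space (set_type U) & Cc_on U (F i)]) /\
     (forall g, f g = \sum_(i < n) F i g)].

Definition factorizations (g : G) : set (G * G) :=
  [set p | src p.1 = rng p.2 /\ gmul p.1 p.2 = g].

(* For f1 in Cc and G etale, only finitely many terms are nonzero: f1 vanishes
   outside finitely many compact sets, each meeting the discrete fibre of rng
   through g in a finite set. *)
Definition convol (f1 f2 : G -> CC R) (g : G) : CC R :=
  \sum_(p \in factorizations g) f1 p.1 * f2 p.2.

Definition convol_star (f : G -> CC R) (g : G) : CC R := (f (ginv g))^*.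

Definition fibre (x : set_type (units G)) : set G := [set g | src g = x].

Definition l2norm (S : set G) (xi : G -> CC R) : \bar R :=
  sqrte (\esum_(g in S) ((modulus (xi g)) ^+ 2)%:E).

(* A vector of l^2(fibre x) is represented by any function on G with the given
   values on the fibre: if gmul g1 g2 = g with g in fibre x then g2 is in
   fibre x, so regular_rep f xi on fibre x only depends on xi on fibre x. *)
Definition regular_rep (f xi : G -> CC R) (g : G) : CC R :=
  \sum_(p \in factorizations g) f p.1 * xi p.2.

Definition regular_rep_norm (x : set_type (units G)) (f : G -> CC R) : \bar R :=
  ereal_sup [set l2norm (fibre x) (regular_rep f xi) |
             xi in [set xi | (l2norm (fibre x) xi <= 1)%E]].

Definition reduced_norm (f : G -> CC R) : \bar R :=
  ereal_sup (range (fun x => regular_rep_norm x f)).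

(* C_0 of the unit space, as functions on G extended by zero *)
Definition C0_units : set (G -> CC R) :=
  [set h | [/\ {within units G, continuous h},
               (forall g, ~ units G g -> h g = 0) &
               forall e : R, 0 < e ->
                 compact (units G `&` [set g | e <= modulus (h g)])]].

End groupoid_functions.

Record cstar_algebra (R : realType) := CstarAlgebra {
  cstar_space :> completeNormedModType (CC R);
  cmul : cstar_space -> cstar_space -> cstar_space;
  cstar : cstar_space -> cstar_space;
  cmulA : associative cmul;
  cmulDl : left_distributive cmul +%R;
  cmulDr : right_distributive cmul +%R;
  cscaleAl : forall (c : CC R) a b, cmul (c *: a) b = c *: cmul a b;
  cscaleAr : forall (c : CC R) a b, cmul a (c *: b) = c *: cmul a b;
  cstarK : involutive cstar;
  cstarD : forall a b, cstar (a + b) = cstar a + cstar b;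
  cstarZ : forall (c : CC R) a, cstar (c *: a) = c^* *: cstar a;
  cstarM : forall a b, cstar (cmul a b) = cmul (cstar b) (cstar a);
  cnormM : forall a b, `|cmul a b| <= `|a| * `|b|;
  cstar_identity : forall a, `|cmul (cstar a) a| = `|a| ^+ 2
}.

(* A with iota is the completion of the *-algebra Cc in the reduced norm; this
   determines (A, iota) up to a unique isometric *-isomorphism. Values of iota
   outside Cc are irrelevant. *)
Record is_reduced_cstar_algebra (R : realType) (G : topological_groupoid)
    (A : cstar_algebra R) (iota : (G -> CC R) -> A) : Prop := {
  iota_linear : forall (c : CC R) f1 f2, Cc f1 -> Cc f2 ->
    iota (fun g => c * f1 g + f2 g) = c *: iota f1 + iota f2;
  iota_conv : forall f1 f2, Cc f1 -> Cc f2 ->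
    iota (convol f1 f2) = cmul (iota f1) (iota f2);
  iota_star : forall f, Cc f -> iota (convol_star f) = cstar (iota f);
  iota_norm : forall f, Cc f -> (modulus `|iota f|)%:E = reduced_norm f;
  iota_dense : dense (iota @` @Cc R G)
}.

(* The copy of C_0(units) in the completion: the isometric extension to C_0 of
   iota on C_c(units), i.e. h in C_0 corresponds to the limit of iota (u n) for
   any u n in C_c(units) tending uniformly to h. *)
Definition C0_image (R : realType) (G : topological_groupoid)
    (A : cstar_algebra R) (iota : (G -> CC R) -> A) : set A :=
  [set a | exists h : G -> CC R, C0_units h /\
     exists u : nat -> G -> CC R,
       [/\ (forall n, Cc_on (units G) (u n)),
           (forall e : R, 0 < e -> \forall n \near \oo,
              forall g, modulus (u n g - h g) < e) &
           iota (u n) @[n --> \oo] --> a]].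

Definition cpositive (R : realType) (A : cstar_algebra R) (a : A) :=
  exists b : A, a = cmul (cstar b) b.

Record is_conditional_expectation (R : realType) (A : cstar_algebra R)
    (B : set A) (E : A -> A) : Prop := {
  cexp_linear : forall (c : CC R) a b, E (c *: a + b) = c *: E a + E b;
  cexp_image : range E = B;
  cexp_idem : forall a, E (E a) = E a;
  cexp_contractive : forall a, `|E a| <= `|a|;
  cexp_positive : forall a, cpositive a -> cpositive (E a);
  cexp_modl : forall b a, B b -> E (cmul b a) = cmul b (E a);
  cexp_modr : forall a b, B b -> E (cmul a b) = cmul (E a) b
}.

Definition faithful (R : realType) (A : cstar_algebra R) (E : A -> A) :=
  forall a : A, E (cmul (cstar a) a) = 0 -> a = 0.

(* Main.v *)
Require Import Defs.
From HB Require Import structures.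
From mathcomp Require Import all_boot all_order all_algebra.
From mathcomp Require Import complex ring.
From mathcomp Require Import all_classical all_reals all_analysis.

(** The groupoid is a bundle of groups of order at most two. Its base is the
    compact space X made of two sequences o_n and e_n of isolated points with
    one common limit oo; the group is trivial over o_n and Z/2 over e_n and over
    oo. The generator over oo is the limit of the generators over e_n, but also
    of the units o_n, so the o_n have two limits and the groupoid is not
    Hausdorff.

    The fibres being abelian, the Fourier transform on each of them turns
    C_c(G) into functions on the space K of characters: one point over each o_n,
    and a trivial and a sign character over e_n and over oo. If a and b are the
    values of f at the two elements over oo, the values f(o_n) tend to a + b,
    which is the value of the transform at the trivial character; hence K
    carries the topology in which o_n and the trivial characters of the fibres
    over e_n converge to the trivial character over oo, while the sign
    characters converge to the sign character. The transform is a bijection of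
    C_c(G) onto C(K) ([gelfand_continuous], [Cc_inv_gelfand]), it is
    multiplicative, and it is isometric for the reduced norm because the regular
    representation of Z/2 is diagonalised by the two characters
    ([reduced_normE]). So C(K) is already the reduced C*-algebra, and C_0(X) is
    the algebra of the functions on K with equal values at the two characters of
    each fibre ([C0_imageP]).

    A conditional expectation onto C_0(X) has to average the two characters of
    each fibre. Over o_n it is the identity, so continuity forces all the weight
    over oo onto the trivial character; restriction to the units, which has
    weights 1/2 and 1/2, is therefore not allowed. The weights 1 - w_n and w_n
    over e_n, with w_n > 0 and w_n tending to 0, do give continuous functions.
    The result is faithful although the sign character over oo has weight zero:
    the points over o_n and e_n are dense in K and all have positive weight
    ([expectation_faithful]). *)

Set Implicit Arguments.
Unset Strict Implicit.
Unset Printing Implicit Defensive.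

Import Order.TTheory GRing.Theory Num.Theory.
Import numFieldNormedType.Exports.

Local Open Scope classical_set_scope.
Local Open Scope ring_scope.

(** * The real modulus of a complex number *)

Section modulus.
Variable R : realType.
Implicit Types z w : CC R.

(** The order and the topology of [CC R] are indexed by elements of [CC R];
    estimates are carried out in [R] and transported by this embedding. *)
Definition ofR (r : R) : CC R := (r%:C)%C.

Lemma ofR_is_zmod_morphism : zmod_morphism ofR.
Proof. by move=> x y; rewrite /ofR rmorphB. Qed.

Lemma ofR_is_monoid_morphism : monoid_morphism ofR.
Proof. by split=> [|x y]; rewrite /ofR ?rmorph1// rmorphM. Qed.

HB.instance Definition _ :=
  GRing.isZmodMorphism.Build R (CC R) ofR ofR_is_zmod_morphism.
HB.instance Definition _ :=
  GRing.isMonoidMorphism.Build R (CC R) ofR ofR_is_monoid_morphism.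

Lemma ler_ofR (x y : R) : (ofR x <= ofR y) = (x <= y).
Proof. exact: lecR. Qed.

Lemma ltr_ofR (x y : R) : (ofR x < ofR y) = (x < y).
Proof. exact: ltcR. Qed.

Lemma normE z : `|z| = ofR (modulus z).
Proof. by case: z => a b; exact: normc_def. Qed.

Lemma ofR_inj : injective ofR.
Proof. by move=> x y []. Qed.

Lemma modulus_ge0 z : 0 <= modulus z.
Proof. by rewrite -ler_ofR rmorph0 -normE. Qed.

Lemma modulus_ofR (r : R) : modulus (ofR r) = `|r|.
Proof. by rewrite /modulus /= expr0n addr0 sqrtr_sqr. Qed.

Lemma modulus0 : modulus (0 : CC R) = 0.
Proof. by rewrite -[0 : CC R](rmorph0 ofR) modulus_ofR normr0. Qed.

Lemma modulus_eq0 z : modulus z = 0 -> z = 0.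
Proof. by move=> z0; apply/normr0_eq0; rewrite normE z0 rmorph0. Qed.

Lemma modulusM z w : modulus (z * w) = modulus z * modulus w.
Proof. by apply: ofR_inj; rewrite rmorphM /= -!normE normrM. Qed.

Lemma modulusD z w : modulus (z + w) <= modulus z + modulus w.
Proof. by rewrite -ler_ofR rmorphD /= -!normE ler_normD. Qed.

Lemma modulusN z : modulus (- z) = modulus z.
Proof. by apply: ofR_inj; rewrite -!normE normrN. Qed.

Lemma modulus_dist z w : `|modulus z - modulus w| <= modulus (z - w).
Proof.
have le z' w' : modulus z' - modulus w' <= modulus (z' - w').
  by rewrite lerBlDr (le_trans _ (modulusD _ _))// subrK.
by rewrite ler_norml lerNl opprB -{1}[z - w]opprB modulusN !le.
Qed.

Lemma modulusJ z : modulus z^* = modulus z.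
Proof. by apply: ofR_inj; rewrite -!normE norm_conjC. Qed.

Lemma modulus_sqr z : ofR (modulus z ^+ 2) = z * z^*.
Proof. by rewrite rmorphXn /= -normE normCK. Qed.

Lemma modulus_parallelogram (p q : CC R) :
  modulus (p + q) ^+ 2 + modulus (p - q) ^+ 2 =
  2 * (modulus p ^+ 2 + modulus q ^+ 2).
Proof.
apply: ofR_inj; rewrite rmorphM rmorph_nat !rmorphD /= !modulus_sqr.
rewrite rmorphB rmorphD.
by ring.
Qed.

(** The Fourier transform on Z/2: convolution by [(a, b)] has the eigenvalues
    [a + b] and [a - b], and by the parallelogram identity their eigenvectors
    are orthogonal. *)
Lemma convolution2_bound (a b u v : CC R) (M : R) :
  modulus (a + b) <= M -> modulus (a - b) <= M ->
  modulus (a * u + b * v) ^+ 2 + modulus (a * v + b * u) ^+ 2 <=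
  M ^+ 2 * (modulus u ^+ 2 + modulus v ^+ 2).
Proof.
move=> abM baM; rewrite -(ler_pM2l (@ltr0n R 2)) -modulus_parallelogram.
rewrite (_ : _ + _ + _ = (a + b) * (u + v)); last by ring.
rewrite (_ : _ + _ - _ = (a - b) * (u - v)); last by ring.
rewrite mulrCA -modulus_parallelogram !modulusM !exprMn mulrDr.
have M0 : 0 <= M by exact: le_trans (modulus_ge0 _) abM.
by rewrite lerD// ler_wpM2r ?sqr_ge0// lerXn2r ?nnegrE ?modulus_ge0.
Qed.

Lemma gt0_ofR (e : CC R) : 0 < e -> exists2 r : R, 0 < r & e = ofR r.
Proof.
move=> e0; exists (complex.Re (e : R[i]%C)); last first.
  by case: e e0 => a b; rewrite ltcE /= => /andP[/eqP -> _].
by case: e e0 => a b; rewrite ltcE /= => /andP[_].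
Qed.

Lemma cvg_modulusP (T : Type) (F : set_system T) (FF : Filter F)
    (f : T -> CC R) (l : CC R) :
  f @ F --> l <->
  forall e : R, 0 < e -> \forall x \near F, modulus (l - f x) < e.
Proof.
split=> [/cvgrPdist_lt fl e e0|fl].
  have /fl : 0 < ofR e by rewrite -(rmorph0 ofR) ltr_ofR.
  by apply: filterS => x; rewrite normE ltr_ofR.
apply/cvgrPdist_lt => e /gt0_ofR[r r0 ->].
by apply: filterS (fl _ r0) => x; rewrite normE ltr_ofR.
Qed.

Lemma Re_le_modulus z : `|complex.Re (z : R[i]%C)| <= modulus z.
Proof.
case: z => a b; rewrite /modulus /= -sqrtr_sqr ler_wsqrtr// lerDl sqr_ge0//.
Qed.

Lemma Im_le_modulus z : `|complex.Im (z : R[i]%C)| <= modulus z.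
Proof.
case: z => a b; rewrite /modulus /= -sqrtr_sqr ler_wsqrtr// lerDr sqr_ge0//.
Qed.

Lemma modulus_le_ReIm z :
  modulus z <= `|complex.Re (z : R[i]%C)| + `|complex.Im (z : R[i]%C)|.
Proof.
case: z => a b; rewrite /modulus /= -[leRHS]ger0_norm ?addr_ge0// -sqrtr_sqr.
rewrite ler_wsqrtr// sqrrD !real_normK ?num_real// lerD2r lerDl.
by rewrite mulrn_wge0// mulr_ge0.
Qed.

(** Completeness of the complex numbers, read off from the real and imaginary
    parts. *)
Lemma cauchy_cvg_CC (F : set_system (CC R)) : ProperFilter F -> cauchy F ->
  exists l : CC R, F --> l.
Proof.
move=> PF /cauchy_ballP cF.
have cpart (f : CC R -> R) :
    (forall z w, `|f z - f w| <= modulus (z - w)) -> cvg (f @ F).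
  move=> fle; apply/cauchy_cvgP/cauchy_ballP => e e0; near_simpl.
  have /cF : 0 < ofR e by rewrite -(rmorph0 ofR) ltr_ofR.
  apply: filterS => -[z w]/=; rewrite -ball_normE /= normE ltr_ofR.
  by rewrite -ball_normE /=; apply: le_lt_trans (fle _ _).
have /cvg_ex[/= a Fa] := cpart (fun z => complex.Re (z : R[i]%C))
  ltac:(by move=> z w; rewrite -raddfB; exact: Re_le_modulus).
have /cvg_ex[/= b Fb] := cpart (fun z => complex.Im (z : R[i]%C))
  ltac:(by move=> z w; rewrite -raddfB; exact: Im_le_modulus).
exists ((a +i* b)%C : CC R).
apply/(@cvg_modulusP _ F _ id) => e e0.
have e2 : 0 < e / 2 by rewrite divr_gt0.
move/cvgrPdist_lt : Fa => /(_ _ e2) Fa; move/cvgrPdist_lt : Fb => /(_ _ e2) Fb.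
near=> z.
apply: le_lt_trans (modulus_le_ReIm _) _; rewrite [ltRHS]splitr ltrD//.
  have : `|a - complex.Re (z : R[i]%C)| < e / 2 by near: z.
  by case: (z).
have : `|b - complex.Im (z : R[i]%C)| < e / 2 by near: z.
by case: (z).
Unshelve. all: by end_near. Qed.

End modulus.

(** * The C*-algebra of bounded continuous functions *)

Section bounded_continuous.
Variables (R : realType) (K : topologicalType).

Definition bounded_by (M : R) (f : K -> CC R) := forall x, modulus (f x) <= M.

Definition is_Cb : {pred K -> CC R} :=
  [pred f : K -> CC R | `[< continuous f /\ exists M, bounded_by M f >]].

Lemma is_CbP (f : K -> CC R) :
  reflect (continuous f /\ exists M, bounded_by M f) (f \in is_Cb).
Proof. exact: asboolP. Qed.

Lemma compact_is_Cb (f : K -> CC R) :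
  compact [set: K] -> continuous f -> f \in is_Cb.
Proof.
move=> cK cf; apply/is_CbP; split=> //.
have /compact_bounded[M [_ fM]] : compact ((@modulus R \o f) @` setT).
  apply: continuous_compact cK; apply: continuous_subspaceT => x.
  apply/cvgrPdist_lt => e e0; have /cvg_modulusP/(_ e e0) := cf x.
  by apply: filterS => y; apply: le_lt_trans (modulus_dist _ _).
exists (M + 1) => x; rewrite -(ger0_norm (modulus_ge0 (f x))).
by apply: (fM (M + 1)); [rewrite ltrDl|exists x].
Qed.

Lemma is_Cb_submod : submod_closed is_Cb.
Proof.
split=> [|c f g /is_CbP[cf [M fM]] /is_CbP[cg [N gN]]]; apply/is_CbP.
  split=> [x|]; first exact: cvg_cst.
  by exists 0 => x; rewrite modulus0.
split=> [x|].
  by apply: cvgD; [apply: cvgM; [exact: cvg_cst|exact: cf]|exact: cg].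
exists (modulus c * M + N) => x; apply: le_trans (modulusD _ _) _.
by rewrite lerD// modulusM ler_wpM2l// modulus_ge0.
Qed.

HB.instance Definition _ :=
  GRing.isSubmodClosed.Build (CC R) (K -> CC R) is_Cb is_Cb_submod.

Record Cb := MkCb { cb_fun :> K -> CC R; cb_funP : cb_fun \in is_Cb }.

HB.instance Definition _ := [isSub for cb_fun].
HB.instance Definition _ := [Choice of Cb by <:].
HB.instance Definition _ := [SubChoice_isSubLmodule of Cb by <:].

Implicit Types a b : Cb.

Lemma CbP a b : a =1 b -> a = b.
Proof. by move=> ab; apply/val_inj/funext. Qed.

Lemma cb_continuous a : continuous a.
Proof. by case/is_CbP: (cb_funP a). Qed.

Lemma cb_bounded a : exists M, bounded_by M a.
Proof. by case/is_CbP: (cb_funP a). Qed.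

Definition supnorm a : R := sup (range (@modulus R \o a)).

Lemma modulus_le_supnorm a x : modulus (a x) <= supnorm a.
Proof.
have [M aM] := cb_bounded a.
by apply: ub_le_sup; [exists M => _ [y _ <-]; exact: aM | exists x].
Qed.

(** The sign condition on [M] covers the empty space, where the
    supremum is 0. *)
Lemma supnorm_le a (M : R) : 0 <= M -> bounded_by M a -> supnorm a <= M.
Proof.
move=> M0 aM; have [E|/set0P ne] := eqVneq (range (@modulus R \o a)) set0.
  by rewrite /supnorm E sup0.
by apply: ge_sup => // _ [y _ <-]; exact: aM.
Qed.

Lemma supnorm_ge0 a : 0 <= supnorm a.
Proof.
have [E|/set0P[x xa]] := eqVneq (range (@modulus R \o a)) set0.
  by rewrite /supnorm E sup0.
case: xa => y _ _; exact: le_trans (modulus_ge0 _) (modulus_le_supnorm a y).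
Qed.

Definition cb_norm a : CC R := ofR (supnorm a).

Lemma cb_normD a b : cb_norm (a + b) <= cb_norm a + cb_norm b.
Proof.
rewrite /cb_norm -rmorphD /= ler_ofR; apply: supnorm_le => [|x].
  by rewrite addr_ge0 ?supnorm_ge0.
apply: le_trans (modulusD _ _) _.
by rewrite lerD ?modulus_le_supnorm.
Qed.

Lemma cb_normZ (c : CC R) a : cb_norm (c *: a) = `|c| * cb_norm a.
Proof.
have supZ (d : CC R) b : supnorm (d *: b) <= modulus d * supnorm b.
  apply: supnorm_le => [|x].
    by rewrite mulr_ge0 ?supnorm_ge0 ?modulus_ge0.
  rewrite [X in modulus X](_ : _ = d * b x)// modulusM.
  by rewrite ler_wpM2l ?modulus_ge0 ?modulus_le_supnorm.
rewrite normE -rmorphM; congr ofR; apply/eqP; rewrite eq_le supZ /=.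
have [->|c0] := eqVneq c 0; first by rewrite modulus0 mul0r supnorm_ge0.
have {1}-> : a = c^-1 *: (c *: a) by rewrite scalerA mulVf// scale1r.
apply: le_trans (ler_wpM2l (modulus_ge0 _) (supZ _ _)) _.
rewrite mulrA -modulusM divff// -[1](rmorph1 (@ofR R)).
by rewrite modulus_ofR normr1 mul1r.
Qed.

Lemma cb_norm0_eq0 a : cb_norm a = 0 -> a = 0.
Proof.
rewrite /cb_norm -(rmorph0 (@ofR R)) => /ofR_inj a0.
apply: CbP => x; apply: modulus_eq0; apply/eqP.
by rewrite eq_le modulus_ge0 andbT -a0 modulus_le_supnorm.
Qed.

HB.instance Definition _ :=
  Lmodule_isNormed.Build (CC R) Cb cb_normD cb_normZ cb_norm0_eq0.

Lemma cb_normE a : `|a| = ofR (supnorm a).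
Proof. by []. Qed.

(** A Cauchy filter converges uniformly to its pointwise limit, which is
    therefore continuous and bounded. *)
Lemma cb_complete (F : set_system Cb) : ProperFilter F -> cauchy F -> cvg F.
Proof.
move=> PF /cauchy_ballP cF.
have dist (e : R) : 0 < e -> \forall ab \near (F, F), forall x : K,
    modulus ((ab.1 : Cb) x - (ab.2 : Cb) x) < e.
  move=> e0; have /cF : 0 < ofR e by rewrite -(rmorph0 (@ofR R)) ltr_ofR.
  apply: filterS => -[a b] /=; rewrite -ball_normE /= cb_normE ltr_ofR => ab x.
  exact: le_lt_trans (modulus_le_supnorm (a - b) x) ab.
have /choice[l Fl] x : exists z : CC R, (fun a : Cb => a x) @ F --> z.
  apply: cauchy_cvg_CC; apply/cauchy_ballP => _ /gt0_ofR[e e0 ->]; near_simpl.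
  apply: filterS (dist e e0) => -[a b] /= /(_ x).
  by rewrite -ball_normE /= normE ltr_ofR.
have Funif (e : R) : 0 < e -> \forall a \near F, forall x : K,
    modulus (l x - (a : Cb) x) < e.
  move=> e0; have e2 : 0 < e / 2 by rewrite divr_gt0.
  have [[P Q]/= [FP FQ] PQ] := dist _ e2.
  apply: filterS FP => a Pa x.
  have [b [Qb lb]] : exists b : Cb, Q b /\ modulus (l x - b x) < e / 2.
    by have /cvg_modulusP/(_ _ e2) Fx := Fl x; apply: filter_ex (filterI FQ Fx).
  rewrite -(subrK (b x) (l x)) -addrA; apply: le_lt_trans (modulusD _ _) _.
  rewrite [ltRHS]splitr ltrD// -opprB modulusN.
  exact: (PQ (a, b)).
have l_continuous : continuous l.
  move=> x; apply/cvg_modulusP => e e0; have e3 : 0 < e / 3 by rewrite divr_gt0.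
  have [a la] := filter_ex (Funif _ e3).
  have /cvg_modulusP/(_ _ e3) := @cb_continuous a x.
  apply: filterS => y axy.
  rewrite (_ : l x - l y = (l x - a x) + (a x - a y) - (l y - a y)); last first.
    by rewrite opprB !addrA !subrK.
  rewrite (_ : e = e / 3 + e / 3 + e / 3); last by field.
  apply: le_lt_trans (modulusD _ _) _; rewrite modulusN ltrD ?la//.
  by apply: le_lt_trans (modulusD _ _) _; rewrite ltrD ?la.
have l_bounded : exists M, bounded_by M l.
  have [a la] := filter_ex (Funif _ ltr01).
  have [M aM] := cb_bounded a; exists (1 + M) => x.
  rewrite -(subrK (a x) (l x)); apply: le_trans (modulusD _ _) _.
  by rewrite lerD// ltW.
have lP : l \in is_Cb by apply/is_CbP.
apply: (cvgP (MkCb lP)); apply/cvgrPdist_le => _ /gt0_ofR[e e0 ->].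
apply: filterS (Funif _ e0) => a la.
rewrite cb_normE ler_ofR; apply: supnorm_le (ltW e0) _ => x.
exact/ltW/la.
Qed.

HB.instance Definition _ := Uniform_isComplete.Build Cb cb_complete.

Lemma is_CbM (f g : K -> CC R) :
  f \in is_Cb -> g \in is_Cb -> (fun x => f x * g x) \in is_Cb.
Proof.
move=> /is_CbP[cf [M fM]] /is_CbP[cg [N gN]]; apply/is_CbP; split=> [x|].
  by apply: cvgM; [exact: cf|exact: cg].
by exists (M * N) => x; rewrite modulusM ler_pM// modulus_ge0.
Qed.

Lemma is_CbJ (f : K -> CC R) : f \in is_Cb -> (fun x => (f x)^*) \in is_Cb.
Proof.
move=> /is_CbP[cf [M fM]]; apply/is_CbP; split=> [x|].
  apply/cvg_modulusP => e e0; have /cvg_modulusP/(_ e e0) := cf x.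
  by apply: filterS => y; rewrite -rmorphB modulusJ.
by exists M => x; rewrite modulusJ.
Qed.

Definition cb_mul a b := MkCb (is_CbM (cb_funP a) (cb_funP b)).
Definition cb_star a := MkCb (is_CbJ (cb_funP a)).

Lemma cb_norm_mul a b : `|cb_mul a b| <= `|a| * `|b|.
Proof.
rewrite !cb_normE -rmorphM ler_ofR.
apply: supnorm_le => [|x]; first by rewrite mulr_ge0 ?supnorm_ge0.
by rewrite modulusM ler_pM ?modulus_ge0 ?modulus_le_supnorm.
Qed.

Lemma cb_cstar_identity a : `|cb_mul (cb_star a) a| = `|a| ^+ 2.
Proof.
rewrite !cb_normE -rmorphXn; congr ofR; apply/eqP; rewrite eq_le.
apply/andP; split.
  apply: supnorm_le => [|x]; first exact: sqr_ge0.
  by rewrite modulusM modulusJ ler_pM ?modulus_ge0 ?modulus_le_supnorm.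
rewrite -[leRHS]sqr_sqrtr ?supnorm_ge0//.
rewrite lerXn2r ?nnegrE ?supnorm_ge0 ?sqrtr_ge0//.
apply: supnorm_le => [|x]; first exact: sqrtr_ge0.
rewrite -(ger0_norm (modulus_ge0 (a x))) -sqrtr_sqr ler_wsqrtr//.
rewrite expr2 -{1}modulusJ -modulusM.
exact: (modulus_le_supnorm (cb_mul (cb_star a) a)).
Qed.

(** Transparent, so that the elements of the algebra remain functions. *)
Definition Cb_cstar : cstar_algebra R.
Proof.
refine (@CstarAlgebra R Cb cb_mul cb_star _ _ _ _ _ _ _ _ _
  cb_norm_mul cb_cstar_identity).
- by move=> a b c; apply: CbP => x; exact: mulrA.
- by move=> a b c; apply: CbP => x; exact: mulrDl.
- by move=> a b c; apply: CbP => x; exact: mulrDr.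
- by move=> k a b; apply: CbP => x; rewrite /= -mulrA.
- by move=> k a b; apply: CbP => x; rewrite /= mulrCA.
- by move=> a; apply: CbP => x; exact: conjCK.
- by move=> a b; apply: CbP => x; exact: rmorphD.
- by move=> k a; apply: CbP => x; exact: rmorphM.
- by move=> a b; apply: CbP => x; rewrite /= rmorphM mulrC.
Defined.

(** The square root of a nonnegative function is continuous. *)
Lemma cpositive_ge0 (a : Cb_cstar) :
  cpositive a <-> forall x, 0 <= (a : Cb) x.
Proof.
split=> [[b ->] x|a0].
  by rewrite /= mulrC -normCK exprn_ge0.
have bP : (fun x => ofR (Num.sqrt (modulus ((a : Cb) x)))) \in is_Cb.
  apply/is_CbP; split=> [x|].
    apply/cvg_modulusP => e e0.
    have sqrta : (fun y => Num.sqrt (modulus ((a : Cb) y))) @ x -->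
        Num.sqrt (modulus ((a : Cb) x)).
      apply: (@cvg_comp _ _ _ (fun y => modulus ((a : Cb) y)) Num.sqrt);
        last exact: sqrt_continuous.
      apply/cvgrPdist_lt => d d0.
      have /cvg_modulusP/(_ d d0) := @cb_continuous a x.
      by apply: filterS => y; apply: le_lt_trans (modulus_dist _ _).
    move/cvgrPdist_lt : sqrta => /(_ e e0); apply: filterS => y.
    by rewrite -rmorphB modulus_ofR.
  have [M aM] := cb_bounded a.
  exists (Num.sqrt M) => x; rewrite modulus_ofR ger0_norm ?sqrtr_ge0//.
  exact: ler_wsqrtr.
exists (MkCb bP); apply: CbP => x /=.
rewrite mulrC -modulus_sqr modulus_ofR real_normK ?num_real//.
by rewrite sqr_sqrtr ?modulus_ge0// -normE ger0_norm.
Qed.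

End bounded_continuous.

(** * Spaces with finitely many branches of isolated points *)

Lemma compact_set_type (T : topologicalType) (A : set T) :
  compact A -> compact [set: set_type A].
Proof.
move=> cA F PF _.
have [|x [Ax clx]] := cA (set_val @ F) _.
  by apply: (@filterS _ F _ setT) filterT => u _; exact: set_valP.
exists (exist (fun y => y \in A) x (mem_set Ax)).
split=> // B W FB [_ [[V oV <-] /= Vx] VW].
have FvB : (set_val @ F) (set_val @` B).
  by apply: (@filterS _ F _ B) FB => u Bu; exists u.
have [_ [[u Bu <-] Vu]] := clx _ _ FvB (open_nbhs_nbhs (conj oV Vx)).
by exists u; split=> //; exact: VW.
Qed.

(** Two limit points [Apex b], and for each label [s] a sequence [Point n s] of
    isolated points. The relation [adh b s] says that the sequence labelled [s]
    converges to [Apex b]. The label [Some b] stands for an element, or a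
    character, of a fibre Z/2, and [None] for a trivial fibre; the groupoid and
    its dual differ only in [adh]. *)
Inductive branched (adh : bool -> option bool -> bool) : Type :=
  Apex of bool | Point of nat & option bool.
Arguments Apex {adh} _.
Arguments Point {adh} _ _.

Section branched.
Variable adh : bool -> option bool -> bool.
Local Notation X := (branched adh).

Definition branched_code (x : X) : bool + nat * option bool :=
  match x with Apex b => inl b | Point n s => inr (n, s) end.

Definition branched_decode (c : bool + nat * option bool) : X :=
  match c with inl b => Apex b | inr (n, s) => Point n s end.

Lemma branched_codeK : cancel branched_code branched_decode.
Proof. by case. Qed.

HB.instance Definition _ := Choice.copy X (can_type branched_codeK).

Definition branched_open (U : set X) :=
  forall b, U (Apex b) ->
    \forall n \near \oo, forall s, adh b s -> U (Point n s).

Lemma branched_openT : branched_open setT.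
Proof. by move=> b _; near=> n. Unshelve. all: by end_near. Qed.

Lemma branched_openI : setI_closed branched_open.
Proof.
move=> U V oU oV b [/oU Ub /oV Vb]; near=> n => s bs.
by split; move: s bs; near: n.
Unshelve. all: by end_near. Qed.

Lemma branched_open_bigcup (I : Type) (U : I -> set X) :
  (forall i, branched_open (U i)) -> branched_open (\bigcup_i U i).
Proof.
move=> oU b [i _ /(oU i)]; apply: filterS => n Un s bs.
by exists i => //; exact: Un.
Qed.

HB.instance Definition _ := isOpenTopological.Build X
  branched_openT branched_openI branched_open_bigcup.

Implicit Types (U A C : set X) (b : bool) (s : option bool).

Lemma branched_openE U : open U = branched_open U.
Proof. by []. Qed.

Lemma open_point n s : open [set Point n s].
Proof. by rewrite branched_openE. Qed.

Lemma open_point_compl n s : open (~` [set Point n s]).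
Proof.
rewrite branched_openE => b _; exists n.+1 => // m /= nm t _ [mn _].
by rewrite mn ltnn in nm.
Qed.

Lemma nbhs_point n s A : A (Point n s) -> nbhs (Point n s) A.
Proof.
move=> Ans; rewrite nbhsE; exists [set Point n s] => [|x -> //].
by split=> //; exact: open_point.
Qed.

Lemma nbhs_apex b A : nbhs (Apex b) A <->
  A (Apex b) /\ \forall n \near \oo, forall s, adh b s -> A (Point n s).
Proof.
split=> [|[Ab AN]].
  rewrite nbhsE => -[U [oU Ub] UA]; split; first exact: UA.
  by move: (oU b Ub); apply: filterS => n Un s /Un/UA.
rewrite nbhsE.
(* [A] without the points that do not converge to [Apex b] is open *)
exists [set x | A x /\ match x with Apex c => c = b | Point n s => adh b s end].
  split=> //; rewrite branched_openE => c [Ac ->].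
  by apply: filterS AN => n An s bs; split=> //; exact: An.
by move=> x [].
Qed.

Lemma apex_cvgP (T : topologicalType) (f : X -> T) b :
  f @ Apex b --> f (Apex b) <->
  forall s, adh b s -> f (Point n s) @[n --> \oo] --> f (Apex b).
Proof.
split=> [fb s bs W /fb /nbhs_apex[_]|fs W Wb].
  by apply: filterS => n; apply.
apply/nbhs_apex; split; first exact: (nbhs_singleton Wb).
have fW s : \forall n \near \oo, adh b s -> W (f (Point n s)).
  have [/fs/(_ _ Wb) fW|_] := boolP (adh b s); last exact: nearW.
  by near=> n => _; near: n; exact: fW.
near=> n; case=> [[]|]; near: n; exact: fW.
Unshelve. all: by end_near. Qed.

Lemma point_cvg (T : topologicalType) (f : X -> T) n s :
  f @ Point n s --> f (Point n s).
Proof. by move=> W /nbhs_singleton Wf; exact: nbhs_point. Qed.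

Lemma branched_continuousP (T : topologicalType) (f : X -> T) :
  continuous f <->
  forall b s, adh b s -> f (Point n s) @[n --> \oo] --> f (Apex b).
Proof.
split=> [cf b|fs]; first by apply/apex_cvgP; exact: cf.
by case=> [b|n s]; [apply/apex_cvgP; exact: fs | exact: point_cvg].
Qed.

(** A Hausdorff open piece with a single limit point. In the groupoid these are
    the two maximal open bisections, and [chart false] is the unit space. *)
Definition chart b : set X :=
  [set x | match x with Apex c => c == b | Point _ s => adh b s end].

Lemma open_chart b : open (chart b).
Proof.
rewrite branched_openE => _ /eqP ->; near=> n.
Unshelve. all: by end_near. Qed.

Lemma chart_continuousP (T : topologicalType) (f : X -> T) b :
  {within chart b, continuous f} <->
  forall s, adh b s -> f (Point n s) @[n --> \oo] --> f (Apex b).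
Proof.
rewrite continuous_open_subspace; last exact: open_chart.
split=> [cf|fs].
  by apply/apex_cvgP; apply: cf; rewrite inE /=.
case=> [c|n s _]; last exact: point_cvg.
by rewrite inE /= => /eqP ->; apply/apex_cvgP.
Qed.

Lemma hausdorff_chart b : hausdorff_space (set_type (chart b)).
Proof.
have valC n s : open (@set_val _ (chart b) @^-1` [set Point n s]) /\
    open (@set_val _ (chart b) @^-1` ~` [set Point n s]).
  split; [exists [set Point n s]|exists (~` [set Point n s])] => //.
  exact: open_point_compl.
rewrite open_hausdorff => x y xy.
have sep n s (u v : set_type (chart b)) : u != v -> val u = Point n s ->
    val v != Point n s.
  by move=> uv <-; apply: contraNneq uv => vu; apply/eqP/val_inj.
case Ex : (val x) => [c|n s]; last first.
  exists (set_val @^-1` [set Point n s], set_val @^-1` ~` [set Point n s]).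
    rewrite !inE/=; split=> //; exact/eqP/(sep _ _ _ _ xy Ex).
  have [oA oB] := valC n s; split=> //.
  by apply/eqP; rewrite -preimage_setI setICr preimage_set0.
case Ey : (val y) => [d|n s]; last first.
  rewrite eq_sym in xy.
  exists (set_val @^-1` ~` [set Point n s], set_val @^-1` [set Point n s]).
    rewrite !inE/=; split=> //; exact/eqP/(sep _ _ _ _ xy Ey).
  have [oA oB] := valC n s; split=> //.
  by apply/eqP; rewrite -preimage_setI setICl preimage_set0.
have := set_valP x; have := set_valP y.
rewrite Ex Ey /= => /eqP db /eqP cb.
by case/eqP: xy; apply/val_inj; rewrite Ex Ey db cb.
Qed.

(** A neighbourhood of [Apex b] misses only finitely many points of
    [chart b]. *)
Lemma compact_branched A b : A `<=` chart b ->
  (A (Apex b) \/ \forall n \near \oo, forall s, ~ A (Point n s)) -> compact A.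
Proof.
move=> Ab Alim.
have fin (N : nat) :
      finite_set [set x : X | exists2 n, (n < N)%N & exists s, x = Point n s].
  apply: (@sub_finite_set _ _
    ((fun p => Point p.1 p.2 : X) @` (`I_N `*` [set: option bool]))).
    by move=> _ [n nN [s ->]]; exists (n, s).
  by apply: finite_image; apply: finite_setX;
    [exact: finite_II|exact: finite_finset].
have [Aapex|nAapex] := pselect (A (Apex b)); last first.
  case: Alim => [//|[N _ AN]].
  apply: finite_compact; apply: sub_finite_set (fin N) => -[c|n s] Ax.
    by move/eqP : (Ab _ Ax) => cb; rewrite cb in Ax.
  exists n; last by exists s.
  by rewrite ltnNge; apply/negP => /AN /(_ s).
move=> F PF FA.
have [cF|ncF] := pselect (cluster F (Apex b)); first by exists (Apex b).
have [B [V [FB bV BV]]] :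
    exists B V, [/\ F B, nbhs (Apex b) V & B `&` V = set0].
  apply: contrapT => nBV; apply: ncF => B V FB bV; apply/set0P/eqP => BV.
  by apply: nBV; exists B, V.
have /nbhs_apex[Vb [N _ VN]] := bV.
have FAB : F (A `&` B) by exact: filterI.
have ABfin : finite_set (A `&` B).
  apply: sub_finite_set (fin N) => -[c|n s] [Ax Bx].
    have /eqP cb := Ab _ Ax.
    suff : (set0 : set X) (Apex b) by [].
    by rewrite -BV; split=> //; rewrite -cb.
  exists n; last by exists s.
  rewrite ltnNge; apply/negP => /VN /(_ s (Ab _ Ax)) Vx.
  suff : (set0 : set X) (Point n s) by [].
  by rewrite -BV.
by have [x [[Ax _] cx]] := finite_compact ABfin PF FAB; exists x.
Qed.

Lemma compact_chart b : compact (chart b).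
Proof. by apply: (@compact_branched _ b) => //; left => /=. Qed.

(** A sequence that meets a compact set infinitely often accumulates there,
    and its only accumulation points are its limits. This controls compactly
    supported functions near a limit point outside their domain. *)
Lemma compact_avoid C s : compact C ->
  (forall b, adh b s -> ~ C (Apex b)) -> \forall n \near \oo, ~ C (Point n s).
Proof.
move=> cC Cs; apply: contrapT => Coften.
(* the sequence, restricted to the indices at which it lies in [C] *)
pose F : set_system X :=
  (fun n => Point n s) @ within [set n | C (Point n s)] \oo.
have PF : ProperFilter F.
  apply: fmap_proper_filter; apply: Build_ProperFilter.
  move=> h; apply: Coften; move: h; rewrite /within /=.
  by apply: filterS => n h Cn; exact: (h Cn).
have [|x [Cx clx]] := cC F PF; first by apply: nearW.
case: x Cx clx => [b|m t] Cx clx.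
  have cV : nbhs (Apex b) [set x | forall n, x <> Point n s].
    apply/nbhs_apex; split=> //; exists 0%N => // n _ t bt k [_ ts].
    by rewrite ts in bt; exact: (Cs _ bt).
  have Fs : F (range (Point^~ s)) by apply: nearW => n _; exists n.
  by have [_ [[n _ <-] /(_ n)]] := clx _ _ Fs cV.
have mV : nbhs (Point m t) [set Point m t] by exact: nbhs_point.
have Fm : F [set x | x <> Point m t].
  by exists m.+1 => // n /= mn _ [nm _]; rewrite nm ltnn in mn.
by have [y []] := clx _ _ Fm mV.
Qed.

(** The two elements of a fibre Z/2, at infinity for [None], uniformly in the
    fibre. *)
Definition isotropy (o : option nat) b : X :=
  if o is Some n then Point n (Some b) else Apex b.

Lemma branched_cases (x : X) :
  (exists n, x = Point n None) \/ exists p b, x = isotropy p b.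
Proof.
case: x => [b|n [b|]]; [right|right|left]; last by exists n.
  by exists None, b.
by exists (Some n), b.
Qed.

End branched.
Arguments isotropy {adh} o b.

(** * The groupoid *)

Lemma fsum_pair (T : choiceType) (V : nmodType) (h : T -> V) (p q : T) :
  p != q -> \sum_(x \in [set p; q]) h x = h p + h q.
Proof.
move=> pq; rewrite fsbigU ?fsbig_set1//.
by move=> x [-> /= qp]; rewrite qp eqxx in pq.
Qed.

(** The [None] sequence consists of units and converges to both elements of the
    fibre at infinity. *)
Definition arrow_adh b (s : option bool) : bool :=
  if s is Some c then c == b else true.

Definition arrow : Type := branched arrow_adh.
HB.instance Definition _ := Topological.on arrow.

Definition unit_sheet (s : option bool) : option bool :=
  if s is Some _ then Some false else None.

Definition unit_of (g : arrow) : arrow :=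
  match g with
  | Apex _ => Apex false
  | Point n s => Point n (unit_sheet s)
  end.

Definition arrow_units : set arrow := chart false.

Lemma unit_ofP g : arrow_units (unit_of g).
Proof. by case: g => [|n []]. Qed.

Definition arrow_src (g : arrow) : set_type arrow_units :=
  exist _ (unit_of g) (mem_set (unit_ofP g)).

Definition sheet_mul (s t : option bool) : option bool :=
  if (s, t) is (Some c, Some d) then Some (c (+) d) else None.

(** The mixed cases never occur for composable arrows. Every element has order
    at most two, so that inversion is the identity. *)
Definition arrow_mul (g h : arrow) : arrow :=
  match g, h with
  | Apex c, Apex d => Apex (c (+) d)
  | Point n s, Point _ t => Point n (sheet_mul s t)
  | _, _ => g
  end.

Lemma arrow_srcE g h : arrow_src g = arrow_src h <-> unit_of g = unit_of h.
Proof. by split=> [/(congr1 val)//|gh]; apply/val_inj. Qed.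

Lemma arrow_src_unit (u : set_type arrow_units) : arrow_src (val u) = u.
Proof.
case: u => g gU; apply/val_inj => /=.
by case: g gU => [b|n [c|]] /set_mem //= /eqP ->.
Qed.

Lemma composableP (g h : arrow) : arrow_src g = arrow_src h ->
  match g, h with
  | Apex _, Apex _ => True
  | Point n s, Point m t => n = m /\ (s == None) = (t == None)
  | _, _ => False
  end.
Proof. by move/arrow_srcE; case: g h => [b|n [b|]] [c|m [c|]] //= []. Qed.

Lemma unit_of_mul (g h : arrow) : arrow_src g = arrow_src h ->
  unit_of (arrow_mul g h) = unit_of g.
Proof. by move/arrow_srcE; case: g h => [b|n [b|]] [c|m [c|]]. Qed.

Lemma arrow_src_mul (g h : arrow) :
  arrow_src g = arrow_src h -> arrow_src (arrow_mul g h) = arrow_src h.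
Proof.
by move=> gh; apply/arrow_srcE; rewrite unit_of_mul//; apply/arrow_srcE.
Qed.

Lemma arrow_rng_mul (g h : arrow) :
  arrow_src g = arrow_src h -> arrow_src (arrow_mul g h) = arrow_src g.
Proof. by move=> gh; apply/arrow_srcE; rewrite unit_of_mul. Qed.

Lemma arrow_mulA (g h k : arrow) :
  arrow_src g = arrow_src h -> arrow_src h = arrow_src k ->
  arrow_mul g (arrow_mul h k) = arrow_mul (arrow_mul g h) k.
Proof.
move=> /composableP + /composableP.
case: g h k => [b|n [b|]] [c|m [c|]] [d|p [d|]] //= _ _.
  by rewrite addbA.
by rewrite /sheet_mul addbA.
Qed.

Lemma arrow_mul_unitl g : arrow_mul (val (arrow_src g)) g = g.
Proof. by case: g => [b|n [b|]]. Qed.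

Lemma arrow_mul_unitr g : arrow_mul g (val (arrow_src g)) = g.
Proof. by case: g => [b|n [b|]] /=; rewrite /sheet_mul ?addbF. Qed.

Lemma arrow_mul_inv g : arrow_mul g g = val (arrow_src g).
Proof. by case: g => [b|n [b|]] /=; rewrite /sheet_mul ?addbb. Qed.

Lemma arrow_mul_continuous :
  {within [set p : arrow * arrow | arrow_src p.1 = arrow_src p.2],
    continuous (fun p : arrow * arrow => arrow_mul p.1 p.2)}.
Proof.
apply/subspace_continuousP => -[g h] /= gh W Wgh.
have := composableP gh; case: g h gh Wgh => [b|n s] [c|m t] //= gh.
  move=> /nbhs_apex[Wbc [N _ WN]] _.
  exists (chart b `&` [set x | if x is Point n _ then (N <= n)%N else True],
          chart c).
    split; [apply/nbhs_apex|apply/nbhs_apex]; split=> //=.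
      by exists N => // n /= Nn s bs.
    by exists 0%N.
  case=> -[b'|n s] [c'|m t] /= [[Hb Hn] Hc] /composableP //.
    rewrite (eqP Hb) (eqP Hc) => _; apply: nbhs_singleton.
    by apply/nbhs_apex; split=> //; exists N.
  case=> _ st; apply: WN => //.
  by case: s t Hb Hc st => [d|] [e|] //= /eqP -> /eqP ->.
move=> Wnm _.
exists ([set Point n s], [set Point m t]); first by split; exact: nbhs_point.
by move=> [g h] /= [-> ->] _; exact: nbhs_singleton Wnm.
Qed.

Definition branched_groupoid : topological_groupoid :=
  @TopologicalGroupoid arrow arrow_units arrow_src arrow_src arrow_mul id
    arrow_src_unit arrow_src_unit arrow_src_mul arrow_rng_mul arrow_mulA
    arrow_mul_unitl arrow_mul_unitr (fun=> erefl) (fun=> erefl)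
    arrow_mul_inv arrow_mul_inv arrow_mul_continuous (fun=> @cvg_id _ _).

(** The [None] sequence runs into every neighbourhood of either limit point. *)
Lemma apex_inseparable (U V : set arrow) b c :
  nbhs (Apex b) U -> nbhs (Apex c) V ->
  exists n, U (Point n None) /\ V (Point n None).
Proof.
move=> /nbhs_apex[_ Ub] /nbhs_apex[_ Vc].
have [n [Un Vn]] := filter_ex (filterI Ub Vc).
by exists n; split; [exact: Un|exact: Vn].
Qed.

Lemma arrow_not_hausdorff : ~ hausdorff_space arrow.
Proof.
move=> hs; suff : (Apex false : arrow) = Apex true by [].
apply: hs => U V Uf Vt.
by have [n] := apex_inseparable Uf Vt; exists (Point n None).
Qed.

(** A Hausdorff open set sees only one of the two elements over infinity. *)
Lemma open_hausdorff_apex (U : set arrow) :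
  open U -> hausdorff_space (set_type U) ->
  forall b c, U (Apex b) -> U (Apex c) -> b = c.
Proof.
move=> oU hU b c Ub Uc.
pose x : set_type U := exist _ (Apex b) (mem_set Ub).
pose y : set_type U := exist _ (Apex c) (mem_set Uc).
suff : x = y by move=> /(congr1 val) [].
apply: hU => V W [_ [[A oA <-] /= Ax] AV] [_ [[B oB <-] /= By] BW].
have nA : nbhs (Apex b : arrow) (A `&` U).
  by apply: open_nbhs_nbhs; split; [exact: openI|].
have nB : nbhs (Apex c : arrow) B by apply: open_nbhs_nbhs.
have [n [[An Un] Bn]] := apex_inseparable nA nB.
exists (exist (fun g => g \in U) _ (mem_set Un)).
by split; [exact: AV|exact: BW].
Qed.

Lemma unit_of_continuous : continuous unit_of.
Proof.
apply/branched_continuousP => b s bs W /nbhs_apex[_].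
by apply: filterS => n; apply; case: s bs.
Qed.

Lemma arrow_src_continuous : continuous arrow_src.
Proof.
apply: continuous_comp_initial.
exact: unit_of_continuous.
Qed.

Lemma arrow_in_chart (g : arrow) : exists b, chart b g.
Proof.
by case: g => [b|n [b|]]; [exists b|exists b|exists false] => /=.
Qed.

Lemma unit_of_open b (V : set arrow) :
  open V -> V `<=` chart b -> open (unit_of @` V).
Proof.
rewrite !branched_openE => oV Vb c [[d|n s] // Vd [<-]].
have /eqP db := Vb _ Vd.
have := oV _ Vd; apply: filterS => n Vn s sc.
case: s sc => [e /eqP ->|_].
  by exists (Point n (Some d)) => //; apply: Vn => /=; rewrite eqxx.
by exists (Point n None) => //; exact: Vn.
Qed.

Lemma unit_of_inj b : {in chart b &, injective unit_of}.
Proof.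
move=> [c|n [c|]] [d|m [d|]]; rewrite !inE //=; try by move=> _ _ [->].
  by move=> /eqP -> /eqP ->.
by move=> /eqP -> /eqP -> [->].
Qed.

(** The charts are open bisections. *)
Lemma arrow_src_local_homeomorphism : local_homeomorphism arrow_src.
Proof.
move=> g; have [b gb] := arrow_in_chart g; exists (chart b); split=> //.
- exact: open_chart.
- by move=> x y xb yb /arrow_srcE; exact: (@unit_of_inj b).
- by apply: continuous_subspaceT; exact: arrow_src_continuous.
- move=> V oV Vb; exists (unit_of @` V); first exact: unit_of_open Vb.
  apply/seteqP; split=> [u [h Vh hu]|_ [h Vh <-]]; last by exists h.
  by exists h => //; apply/val_inj.
Qed.

Lemma branched_groupoid_etale : etale branched_groupoid.
Proof.
split; [exact: hausdorff_chart| |exact: arrow_src_local_homeomorphism..].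
move=> x _; exists setT; first exact: filterT.
split; [exact/compact_set_type/compact_chart|exact: closedT].
Qed.

(** * Compactly supported functions *)

Section compactly_supported.
Variable R : realType.
Implicit Types f : arrow -> CC R.

(** A function supported in one chart contributes its limit along [None] to
    just one of the two values at infinity, hence the sum. *)
Definition sheet_limits f :=
  (forall c, f (Point n (Some c)) @[n --> \oo] --> f (Apex c)) /\
  f (Point n None) @[n --> \oo] --> f (Apex false) + f (Apex true).

Lemma sheet_limitsD f1 f2 : sheet_limits f1 -> sheet_limits f2 ->
  sheet_limits (f1 + f2).
Proof.
move=> [f1c f1N] [f2c f2N]; split=> [c|]; first exact: cvgD (f1c c) (f2c c).
by rewrite addrACA; exact: cvgD f1N f2N.
Qed.

(** Where the domain contains a limit point of a sequence, continuity applies;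
    elsewhere the function is eventually zero on the sequence by
    [compact_avoid]. *)
Lemma Cc_on_sheet_limits (U : set branched_groupoid) f :
  open U -> hausdorff_space (set_type U) -> Cc_on U f -> sheet_limits f.
Proof.
move=> oU hU [cf f0 cU]; rewrite continuous_open_subspace// in cf.
have cvg_in b s : U (Apex b) -> arrow_adh b s ->
    f (Point n s) @[n --> \oo] --> f (Apex b).
  by move=> Ub bs; apply: (apex_cvgP f b).1 _ s bs; apply: cf; rewrite inE.
have cvg_out s : (forall b, arrow_adh b s -> ~ U (Apex b)) ->
    f (Point n s) @[n --> \oo] --> (0 : CC R).
  move=> sU; apply: cvg_near_cst.
  have := compact_avoid cU (fun b bs => fun H => sU b bs H.1).
  apply: filterS => n nC; apply: contrapT => fn; apply: nC; split.
    by apply: contrapT => /f0.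
  by apply: subset_closure; apply/eqP.
split=> [c|].
  have [Uc|nUc] := pselect (U (Apex c)).
    exact: (cvg_in c (Some c) Uc (eqxx c)).
  by rewrite f0//; apply: cvg_out => b /= /eqP <-.
have [Uf|nUf] := pselect (U (Apex false)).
  rewrite [f (Apex true)]f0 ?addr0; last first.
    by move=> Ut; have := open_hausdorff_apex oU hU Uf Ut.
  exact: (cvg_in _ None Uf).
rewrite [f (Apex false)]f0// add0r.
have [Ut|nUt] := pselect (U (Apex true)); first exact: (cvg_in _ None Ut).
by rewrite f0//; apply: cvg_out => -[].
Qed.

(** A splitting of [f] into pieces supported in the two charts: the piece on
    [chart true] is made constant along [None], the other one takes the rest. *)
Definition chart_part f (c : bool) (g : arrow) : CC R :=
  match g with
  | Apex d => if d == c then f (Apex c) else 0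
  | Point n (Some d) => if d == c then f (Point n (Some d)) else 0
  | Point n None =>
      if c then f (Apex true) else f (Point n None) - f (Apex true)
  end.

Lemma Cc_on_chart_part f c :
  sheet_limits f -> Cc_on (chart c : set branched_groupoid) (chart_part f c).
Proof.
move=> [fc fN]; split.
- apply/chart_continuousP => -[d /eqP ->|_] /=.
    by rewrite eqxx; exact: fc.
  rewrite eqxx; case: (c); first exact: (cvg_cst (f (Apex true))).
  rewrite -[f (Apex false)](addrK (f (Apex true))).
  exact: (cvgB fN (cvg_cst (f (Apex true)))).
- by move=> [d|n [d|]] /=; first [case: (d == c) | move/(_ isT)].
- by apply: compact_closedI; [exact: compact_chart|exact: closed_closure].
Qed.

Lemma CcP f : @Cc R branched_groupoid f <-> sheet_limits f.
Proof.
split=> [[n [F [FU fF]]]|fl].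
  have Fl i : sheet_limits (F i).
    by have [U [oU hU FUi]] := FU i; exact: Cc_on_sheet_limits FUi.
  have -> : f = \sum_(i < n) F i.
    by apply/funext => g; rewrite fct_sumE; exact: fF.
  elim/big_ind : _ => [|f1 f2 f1l f2l|//].
    by split=> [c|]; [exact: cvg_cst|rewrite addr0; exact: cvg_cst].
  exact: sheet_limitsD.
exists 2%N, (fun i => chart_part f (i != 0 :> nat)); split=> [i|g].
  exists (chart (i != 0 :> nat)).
  by split; [exact: open_chart|exact: hausdorff_chart|exact: Cc_on_chart_part].
rewrite 2!big_ord_recl big_ord0 /=.
by case: g => [[]|n [[]|]] /=; rewrite ?addr0 ?add0r ?subrK.
Qed.

End compactly_supported.

(** * The Fourier transform onto the spectrum *)

(** The points are the characters of the fibres: [Some false] labels the trivial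
    characters and [Some true] the sign characters. The characters of the
    trivial fibres converge to the trivial character at infinity. *)
Definition spectrum_adh b (s : option bool) : bool := odflt false s == b.
Definition spectrum : Type := branched spectrum_adh.
HB.instance Definition _ := Topological.on spectrum.

Lemma compact_spectrum : compact [set: spectrum].
Proof.
have -> : [set: spectrum] = chart false `|` chart true.
  apply/esym/seteqP; split=> // -[[]|n [[]|]] _; by [left|right].
by apply: compactU; exact: compact_chart.
Qed.

Section gelfand.
Variable R : realType.
Implicit Types f : arrow -> CC R.

Definition gelfand f (k : spectrum) : CC R :=
  match k with
  | Point n None => f (Point n None)
  | Apex b => f (Apex false) + (-1) ^+ b * f (Apex true)
  | Point n (Some b) =>
      f (Point n (Some false)) + (-1) ^+ b * f (Point n (Some true))
  end.

Lemma gelfand_isotropy f o b :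
  gelfand f (isotropy o b) =
  f (isotropy o false) + (-1) ^+ b * f (isotropy o true).
Proof. by case: o. Qed.

Lemma gelfand_continuous f : sheet_limits f -> continuous (gelfand f).
Proof.
move=> [fc fN]; apply/branched_continuousP => b [c|] /eqP /= <-; last first.
  by rewrite mul1r.
exact: cvgD (fc false) (cvgM (cvg_cst ((-1) ^+ c : CC R)) (fc true)).
Qed.

Lemma Cc_gelfand f :
  @Cc R branched_groupoid f -> gelfand f \in @is_Cb R spectrum.
Proof.
move=> /CcP fl; apply: compact_is_Cb; first exact: compact_spectrum.
exact: gelfand_continuous.
Qed.

(** Outside [Cc] the transform need not be continuous, and the value is 0. *)
Definition Cc_embedding f : Cb R spectrum := insubd 0 (gelfand f).

Lemma Cc_embeddingE f k :
  @Cc R branched_groupoid f -> Cc_embedding f k = gelfand f k.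
Proof.
by move=> /Cc_gelfand fC; rewrite /Cc_embedding [cb_fun _](insubdK _ fC).
Qed.

Definition inv_gelfand (a : Cb R spectrum) (g : arrow) : CC R :=
  match g with
  | Point n None => a (Point n None)
  | Apex b => (a (Apex false) + (-1) ^+ b * a (Apex true)) / 2
  | Point n (Some b) =>
      (a (Point n (Some false)) + (-1) ^+ b * a (Point n (Some true))) / 2
  end.

Lemma Cb_spectrum_cvg (a : Cb R spectrum) s :
  a (Point n s) @[n --> \oo] --> a (Apex (odflt false s)).
Proof.
have /branched_continuousP ac := @cb_continuous _ _ a.
by apply: ac; rewrite /spectrum_adh.
Qed.

Lemma Cc_inv_gelfand a : @Cc R branched_groupoid (inv_gelfand a).
Proof.
have a0 := @Cb_spectrum_cvg a (Some false).
have a1 := @Cb_spectrum_cvg a (Some true).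
have cst (z : CC R) : z @[n --> \oo] --> z by exact: cvg_cst.
apply/CcP; split=> [c|]; first exact: cvgM (cvgD a0 (cvgM (cst _) a1)) (cst _).
rewrite [X in _ --> X](_ : _ = a (Apex false)).
  exact: (@Cb_spectrum_cvg a None).
by rewrite /= expr0 expr1; field.
Qed.

Lemma Cc_embedding_inv_gelfand a : Cc_embedding (inv_gelfand a) = a.
Proof.
apply: CbP => k; rewrite Cc_embeddingE; last exact: Cc_inv_gelfand.
by case: k => [[]|n [[]|]] //=; rewrite ?expr0 ?expr1; field.
Qed.

Lemma factorizationsE (g : branched_groupoid) : factorizations g =
  [set p | unit_of p.1 = unit_of p.2 /\ arrow_mul p.1 p.2 = g].
Proof. by apply/seteqP; split=> p [pp pg]; split=> //; apply/arrow_srcE. Qed.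

Lemma factorizations_isotropy o b :
  factorizations (isotropy o b : branched_groupoid) =
  [set (isotropy o false, isotropy o b : arrow);
       (isotropy o true, isotropy o (~~ b))].
Proof.
rewrite factorizationsE; apply/seteqP; split=> [[g h]|_ [->|->]].
- case: o g h => [n|] [c|m [c|]] [d|p [d|]] //= [] //.
    by case=> <- [<- <-]; case: c; [right|left]; case: d.
  by move=> _ [<-]; case: c; [right|left]; case: d.
- by case: o.
- by case: o => [n|]; case: b.
Qed.

Lemma factorizations_trivial n :
  factorizations (Point n None : branched_groupoid) =
  [set (Point n None, Point n None : arrow)].
Proof.
rewrite factorizationsE; apply/seteqP; split=> [[g h]|_ ->] //.
by case: g h => [b|m [b|]] [c|p [c|]] //= [] // [->] [->].
Qed.

Lemma fsum_isotropy o b (h : arrow * arrow -> CC R) :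
  \sum_(p \in factorizations (isotropy o b : branched_groupoid)) h p =
  h (isotropy o false, isotropy o b) + h (isotropy o true, isotropy o (~~ b)).
Proof.
by rewrite factorizations_isotropy fsum_pair//; apply/eqP; case: o => [n|] [].
Qed.

Lemma gelfand_convol f1 f2 k :
  gelfand (@convol R branched_groupoid f1 f2) k = gelfand f1 k * gelfand f2 k.
Proof.
case: (branched_cases k) => [[n ->]|[p [b ->]]].
  by rewrite /= /convol factorizations_trivial fsbig_set1.
rewrite !gelfand_isotropy /convol !fsum_isotropy /=.
by case: b; rewrite ?expr0 ?expr1; ring.
Qed.

Lemma gelfand_star f k :
  gelfand (@convol_star R branched_groupoid f) k = (gelfand f k)^*.
Proof.
case: k => [b|n [b|]] //=;
  by rewrite /convol_star rmorphD rmorphM rmorphXn rmorphN1.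
Qed.

Lemma gelfand_linear (c : CC R) f1 f2 k :
  gelfand (fun g => c * f1 g + f2 g) k = c * gelfand f1 k + gelfand f2 k.
Proof. by case: k => [b|n [b|]] //=; ring. Qed.

End gelfand.

(** * The reduced norm *)

Section reduced_norm.
Variable R : realType.
Implicit Types f xi : arrow -> CC R.

Lemma fibre_isotropy p (x : set_type (units branched_groupoid)) :
  val x = isotropy p false ->
  fibre x = [set isotropy p false; isotropy p true].
Proof.
move=> xp; have fibE g : fibre x g <-> unit_of g = isotropy p false.
  by rewrite -xp; split=> [<-//|gx]; apply/val_inj.
apply/seteqP; split=> g; rewrite fibE.
  case: p g {xp fibE} => [n|] [b|m [[]|]] //=.
  - by move=> [->]; right.
  - by move=> [->]; left.
  - by case: b; [right|left].
by case: p {xp fibE} => [n|] [->|->].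
Qed.

Lemma fibre_trivial n (x : set_type (units branched_groupoid)) :
  val x = Point n None -> fibre x = [set (Point n None : arrow)].
Proof.
move=> xn; have fibE g : fibre x g <-> unit_of g = Point n None.
  by rewrite -xn; split=> [<-//|gx]; apply/val_inj.
apply/seteqP; split=> g; rewrite fibE; last by move=> ->.
by case: g => [b|m [b|]] //= [->].
Qed.

Lemma l2norm_set1 (g : branched_groupoid) xi :
  l2norm [set g] xi = (modulus (xi g))%:E.
Proof.
rewrite /l2norm esum_set1 ?lee_fin ?sqr_ge0//=.
by rewrite sqrtr_sqr ger0_norm ?modulus_ge0.
Qed.

Lemma l2norm_set2 (g h : branched_groupoid) xi : g != h ->
  l2norm [set g; h] xi =
  (Num.sqrt (modulus (xi g) ^+ 2 + modulus (xi h) ^+ 2))%:E.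
Proof.
move=> gh; rewrite /l2norm esum_fset => [|//|k _]; last first.
- by rewrite lee_fin sqr_ge0.
- by rewrite fsum_pair.
Qed.

Lemma isotropy_neq p :
  (isotropy p false : branched_groupoid) != isotropy p true.
Proof. by apply/eqP; case: p. Qed.

Lemma regular_rep_isotropy f xi p b :
  @regular_rep R branched_groupoid f xi (isotropy p b) =
  f (isotropy p false) * xi (isotropy p b) +
  f (isotropy p true) * xi (isotropy p (~~ b)).
Proof. by rewrite /regular_rep fsum_isotropy. Qed.

Lemma regular_rep_trivial f xi n :
  @regular_rep R branched_groupoid f xi (Point n None) =
  f (Point n None) * xi (Point n None).
Proof. by rewrite /regular_rep factorizations_trivial fsbig_set1. Qed.

Lemma unit_cases (x : set_type (units branched_groupoid)) :
  (exists n, val x = Point n None) \/ (exists p, val x = isotropy p false).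
Proof.
case: x => -[b|n [b|]] /[dup] xU /set_mem /=.
- by move/eqP => ->; right; exists None.
- by move/eqP => ->; right; exists (Some n).
- by left; exists n.
Qed.

(** Each regular representation is multiplication by one value of the transform
    or a 2 by 2 convolution, bounded by [convolution2_bound]. *)
Lemma reduced_norm_le f (M : R) : 0 <= M ->
  (forall k, modulus (gelfand f k) <= M) ->
  (@reduced_norm R branched_groupoid f <= M%:E)%E.
Proof.
move=> M0 fM; apply: ge_ereal_sup => _ [x _ <-].
apply: ge_ereal_sup => _ [xi xi1 <-].
case: (unit_cases x) xi1 => [[n xE]|[p xE]]; rewrite /=.
  rewrite (fibre_trivial xE) !l2norm_set1 !lee_fin => xi1.
  rewrite regular_rep_trivial modulusM -[leRHS]mulr1 ler_pM ?modulus_ge0//.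
  exact: (fM (Point n None)).
rewrite (fibre_isotropy xE) !l2norm_set2 ?isotropy_neq// !lee_fin => xi1.
have xi2 : modulus (xi (isotropy p false)) ^+ 2 +
    modulus (xi (isotropy p true)) ^+ 2 <= 1.
  by rewrite -(ler_sqrt _ ler01) sqrtr1.
rewrite !regular_rep_isotropy /= -[leRHS](ger0_norm M0) -sqrtr_sqr ler_wsqrtr//.
apply: le_trans
  (@convolution2_bound _ (f (isotropy p false)) (f (isotropy p true)) _ _ M _ _)
  _.
- by have := fM (isotropy p false); rewrite gelfand_isotropy mul1r.
- by have := fM (isotropy p true); rewrite gelfand_isotropy expr1 mulN1r.
- by rewrite -[leRHS]mulr1 ler_wpM2l// sqr_ge0.
Qed.

(** Each value of the transform is an eigenvalue of a regular representation,
    with the character as eigenvector. *)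
Lemma gelfand_le_reduced_norm f k :
  ((modulus (gelfand f k))%:E <= @reduced_norm R branched_groupoid f)%E.
Proof.
case: (branched_cases k) => [[n ->]|[p [b ->]]].
  pose x : set_type (units branched_groupoid) := arrow_src (Point n None).
  have xE : val x = Point n None by [].
  apply: le_ereal_sup_tmp; exists (regular_rep_norm x f); first by exists x.
  apply: le_ereal_sup_tmp.
  exists (l2norm (fibre x) (@regular_rep R branched_groupoid f (fun=> 1))).
    exists (fun=> 1) => //=.
    rewrite (fibre_trivial xE) l2norm_set1 -[1](rmorph1 (@ofR R)).
    by rewrite modulus_ofR normr1.
  by rewrite (fibre_trivial xE) l2norm_set1 regular_rep_trivial mulr1.
pose x : set_type (units branched_groupoid) := arrow_src (isotropy p false).
have xE : val x = isotropy p false by rewrite /x /=; case: (p).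
(* the character [b], normalised to length one in l^2 of two points *)
pose xi (g : arrow) : CC R := ofR (Num.sqrt (2^-1)) *
  match g with Apex c | Point _ (Some c) => (-1) ^+ (b && c) | _ => 0 end.
have xiE c : xi (isotropy p c) = ofR (Num.sqrt (2^-1)) * (-1) ^+ (b && c).
  by rewrite /xi; case: (p).
have xi_norm : l2norm (fibre x) xi = 1%E.
  rewrite (fibre_isotropy xE) l2norm_set2 ?isotropy_neq// !xiE !modulusM.
  have sign1 (c : bool) : modulus ((-1) ^+ c : CC R) = 1.
    by apply: (@ofR_inj R); rewrite -normE normrX normrN1 expr1n rmorph1.
  rewrite !sign1 !mulr1 modulus_ofR real_normK ?num_real//.
  rewrite sqr_sqrtr ?invr_ge0//.
  by rewrite (_ : 2^-1 + 2^-1 = 1) ?sqrtr1//; field.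
apply: le_ereal_sup_tmp; exists (regular_rep_norm x f); first by exists x.
apply: le_ereal_sup_tmp.
exists (l2norm (fibre x) (@regular_rep R branched_groupoid f xi)).
  by exists xi => //=; rewrite xi_norm.
have eig c : @regular_rep R branched_groupoid f xi (isotropy p c) =
    gelfand f (isotropy p b) * xi (isotropy p c).
  rewrite regular_rep_isotropy gelfand_isotropy !xiE.
  by case: b {xi xiE xi_norm}; case: c => /=; rewrite ?expr0 ?expr1; ring.
(* otherwise rewriting would unfold [xi] *)
clearbody xi; move: xi_norm; rewrite (fibre_isotropy xE).
rewrite !l2norm_set2 ?isotropy_neq// !eig !modulusM.
rewrite !exprMn -mulrDr => -[xi1].
by rewrite sqrtrM ?sqr_ge0// xi1 sqrtr_sqr mulr1 ger0_norm ?modulus_ge0.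
Qed.

Lemma reduced_normE f (a : Cb R spectrum) : (forall k, a k = gelfand f k) ->
  (supnorm a)%:E = @reduced_norm R branched_groupoid f.
Proof.
move=> aE; apply/eqP; rewrite eq_le; apply/andP; split; last first.
  apply: reduced_norm_le => [|k]; first exact: supnorm_ge0.
  by rewrite -aE modulus_le_supnorm.
case E : (@reduced_norm R branched_groupoid f) => [r| |]; last 2 first.
- by rewrite leey.
- by have := gelfand_le_reduced_norm f (Apex false); rewrite E.
rewrite lee_fin; apply: supnorm_le => [|k].
  have := gelfand_le_reduced_norm f (Apex false); rewrite E lee_fin.
  exact: le_trans (modulus_ge0 _).
by rewrite aE -lee_fin -E gelfand_le_reduced_norm.
Qed.

End reduced_norm.

(** * The reduced C*-algebra and its expectation *)

Section reduced_algebra.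
Variable R : realType.
Local Notation A := (Cb_cstar R spectrum).
Local Notation CK := (Cb R spectrum).
Implicit Types (a : CK) (f : arrow -> CC R).

Lemma Cc_embedding_unique f a :
  (forall k, gelfand f k = a k) -> Cc_embedding f = a.
Proof.
move=> fa; apply: CbP => k.
rewrite /Cc_embedding [cb_fun _]insubdK//.
by rewrite (_ : gelfand f = a) ?cb_funP//; exact/funext.
Qed.

Lemma Cc_embedding_reduced :
  @is_reduced_cstar_algebra R branched_groupoid A (@Cc_embedding R).
Proof.
split=> [c f1 f2 f1C f2C|f1 f2 f1C f2C|f fC|f fC|].
- by apply: Cc_embedding_unique => k; rewrite gelfand_linear -!Cc_embeddingE.
- by apply: Cc_embedding_unique => k; rewrite gelfand_convol -!Cc_embeddingE.
- by apply: Cc_embedding_unique => k; rewrite gelfand_star -Cc_embeddingE.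
- rewrite cb_normE modulus_ofR ger0_norm ?supnorm_ge0//.
  by apply: reduced_normE => k; rewrite Cc_embeddingE.
- move=> O [a Oa] _; exists a; split=> //.
  exists (inv_gelfand a); first exact: Cc_inv_gelfand.
  exact: Cc_embedding_inv_gelfand.
Qed.

Lemma Cc_on_unitsW (f : branched_groupoid -> CC R) :
  Cc_on (units branched_groupoid) f -> Cc f.
Proof.
move=> fC; exists 1%N, (fun=> f); split=> [_|g]; last by rewrite big_ord1.
exists (units branched_groupoid).
by split=> //; [exact: open_chart|exact: hausdorff_chart].
Qed.

(** Reads a function on the spectrum as one on the unit space, by means of the
    trivial characters. *)
Definition on_units a (g : arrow) : CC R :=
  match g with
  | Apex b => if b then 0 else a (Apex false)
  | Point n s => if s == Some true then 0 else a (Point n s)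
  end.

Lemma on_units_cvg a s : arrow_adh false s ->
  on_units a (Point n s) @[n --> \oo] --> a (Apex false).
Proof. by case: s => [[]|] //= _; exact: Cb_spectrum_cvg. Qed.

Lemma on_units_C0 a : @C0_units R branched_groupoid (on_units a).
Proof.
split=> [||e e0].
- by apply/chart_continuousP => s sP; exact: on_units_cvg.
- by move=> [[]|n [[]|]] // nU; case: nU.
- apply: (@compact_branched _ _ false) => [x []//|].
  have [|ae] := boolP (e <= modulus (a (Apex false))); [by left|right].
  rewrite -ltNge in ae.
  have lt_cvg s : arrow_adh false s ->
      \forall n \near \oo, modulus (on_units a (Point n s)) < e.
    move=> /(@on_units_cvg a) /cvg_modulusP/(_ (e - modulus (a (Apex false)))).
    rewrite subr_gt0 => /(_ ae); apply: filterS => n an.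
    rewrite -(subKr (a (Apex false)) (on_units _ _)).
    apply: le_lt_trans (modulusD _ _) _.
    by rewrite modulusN addrC -ltrBrDr.
  have lt0 := lt_cvg None isT; have lt1 := lt_cvg (Some false) isT.
  near=> n => s [/= sP]; apply/negP; rewrite -ltNge.
  by case: s sP => [[]|] // _; near: n.
Unshelve. all: by end_near. Qed.

Lemma on_units_Cc a :
  @Cc_on R branched_groupoid (units branched_groupoid) (on_units a).
Proof.
have [ha h0 _] := on_units_C0 a; split=> //.
by apply: compact_closedI; [exact: compact_chart|exact: closed_closure].
Qed.

(** A function supported on the units has the same transform at both characters
    of a fibre. *)
Definition isotropy_invariant a :=
  forall p b, a (isotropy p b) = a (isotropy p false).

Lemma Cc_embedding_on_units a :
  isotropy_invariant a -> Cc_embedding (on_units a) = a.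
Proof.
move=> ai; apply: Cc_embedding_unique => k.
case: (branched_cases k) => [[n ->]//|[p [b ->]]].
rewrite gelfand_isotropy ai.
by case: p => [n|] /=; rewrite mulr0 addr0.
Qed.

(** Invariance passes to norm limits because evaluations are contractive.
    Conversely, as the unit space is compact, the approximating sequence may be
    taken constant. *)
Lemma C0_imageP a :
  @C0_image R branched_groupoid A (@Cc_embedding R) a <-> isotropy_invariant a.
Proof.
split=> [[h [_ [u [uC _ ua]]]] p b|ai].
  apply/eqP; rewrite -subr_eq0; apply/eqP/modulus_eq0/le_anti.
  rewrite modulus_ge0 andbT; apply/ler_addgt0Pl => e e0; rewrite addr0.
  have e2 : 0 < ofR (e / 2) by rewrite -(rmorph0 (@ofR R)) ltr_ofR divr_gt0.
  have /cvgrPdist_lt/(_ _ e2) := ua.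
  move=> /filter_ex[n]; rewrite cb_normE ltr_ofR => an.
  have anx k : modulus (a k - Cc_embedding (u n) k) < e / 2.
    exact: le_lt_trans (modulus_le_supnorm (a - Cc_embedding (u n)) k) an.
  have uCc := Cc_on_unitsW (uC n).
  have un : Cc_embedding (u n) (isotropy p b) =
      Cc_embedding (u n) (isotropy p false).
    rewrite !Cc_embeddingE// !gelfand_isotropy.
    have [_ u0 _] := uC n.
    by rewrite [u n (isotropy p true)]u0 ?mulr0//; case: (p).
  rewrite (_ : _ - _ = (a (isotropy p b) - Cc_embedding (u n) (isotropy p b)) -
    (a (isotropy p false) - Cc_embedding (u n) (isotropy p false))); last first.
    by rewrite un opprB addrA subrK.
  by rewrite (le_trans (modulusD _ _))// modulusN [leRHS]splitr lerD// ltW.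
exists (on_units a); split; first exact: on_units_C0.
exists (fun=> on_units a); split=> [n|e e0|]; first exact: on_units_Cc.
  by near=> n => g; rewrite subrr modulus0.
by rewrite Cc_embedding_on_units//; exact: cvg_cst.
Unshelve. all: by end_near. Qed.

Definition weight (n : nat) : R := n.+2%:R^-1.

Lemma weight_gt0 n : 0 < weight n.
Proof. by rewrite invr_gt0. Qed.

Lemma weight_lt1 n : 0 < 1 - weight n.
Proof. by rewrite subr_gt0 invf_lt1// ltr1n. Qed.

Lemma weight_cvg : ofR (weight n) @[n --> \oo] --> (0 : CC R).
Proof.
apply/cvg_modulusP => e e0.
have : weight n @[n --> \oo] --> (0 : R).
  by have := @cvg_harmonic R; rewrite -cvg_shiftS.
move=> /cvgrPdist_lt/(_ e e0); apply: filterS => n.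
by rewrite !sub0r modulusN modulus_ofR normrN.
Qed.

(** The weights at infinity are 1 and 0, the limits of those at [n]. Along
    [None] nothing is averaged, which forces these limits. *)
Definition average a (k : spectrum) : CC R :=
  match k with
  | Apex _ => a (Apex false)
  | Point n None => a (Point n None)
  | Point n (Some _) =>
      ofR (1 - weight n) * a (Point n (Some false)) +
      ofR (weight n) * a (Point n (Some true))
  end.

Lemma average_Cb a : average a \in @is_Cb R spectrum.
Proof.
apply: compact_is_Cb; first exact: compact_spectrum.
apply/branched_continuousP => b [c|] _ /=; last exact: Cb_spectrum_cvg.
have w1 : ofR (1 - weight n) @[n --> \oo] --> (1 : CC R).
  rewrite -[X in _ --> X]subr0.
  under eq_fun do rewrite rmorphB rmorph1.
  exact: cvgB (cvg_cst (1 : CC R)) weight_cvg.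
(* the sign characters converge as well, but their weight tends to zero *)
have -> : a (Apex false) = 1 * a (Apex false) + 0 * a (Apex true).
  by rewrite mul1r mul0r addr0.
exact: cvgD (cvgM w1 (@Cb_spectrum_cvg _ a (Some false)))
  (cvgM weight_cvg (@Cb_spectrum_cvg _ a (Some true))).
Qed.

Definition expectation (a : A) : A := MkCb (average_Cb a).

Lemma expectation_invariant a : isotropy_invariant (expectation a : CK).
Proof. by move=> [n|] b. Qed.

Lemma weightK n (z : CC R) : ofR (1 - weight n) * z + ofR (weight n) * z = z.
Proof. by rewrite -mulrDl -rmorphD subrK rmorph1 mul1r. Qed.

Lemma expectation_id a : isotropy_invariant a -> expectation a = a.
Proof.
move=> ai; apply: CbP => -[b|n [b|]] //=.
- exact: esym (ai None b).
- by rewrite (ai (Some n) true) weightK; exact: esym (ai (Some n) b).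
Qed.

Lemma expectation_contractive (a : A) : `|expectation a| <= `|a|.
Proof.
rewrite !cb_normE ler_ofR; apply: supnorm_le; first exact: supnorm_ge0.
move=> [b|n [b|]] /=; try exact: modulus_le_supnorm.
have w0 := ltW (weight_gt0 n); have w1 := ltW (weight_lt1 n).
apply: le_trans (modulusD _ _) _; rewrite !modulusM !modulus_ofR !ger0_norm//.
rewrite -[leRHS]mul1r -[X in X * supnorm a](subrK (weight n) 1) [leRHS]mulrDl.
by rewrite lerD// ler_wpM2l// modulus_le_supnorm.
Qed.

Lemma ofR_gt0 (r : R) : 0 < r -> 0 < ofR r.
Proof. by move=> r0; rewrite -(rmorph0 (@ofR R)) ltr_ofR. Qed.

Lemma expectation_conditional :
  is_conditional_expectation
    (@C0_image R branched_groupoid A (@Cc_embedding R)) expectation.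
Proof.
split.
- move=> c a b; apply: CbP => -[d|n [d|]] //=.
  rewrite [LHS](_ : _ = ofR (1 - weight n) *
      (c * (a : CK) (Point n (Some false)) + (b : CK) (Point n (Some false))) +
    ofR (weight n) *
      (c * (a : CK) (Point n (Some true)) + (b : CK) (Point n (Some true))))//.
  rewrite [RHS](_ : _ = c * expectation a (Point n (Some d)) +
    expectation b (Point n (Some d)))//=.
  by ring.
- apply/seteqP; split=> [_ [a _ <-]|a /C0_imageP ai].
    exact/C0_imageP/expectation_invariant.
  by exists a => //; exact: expectation_id.
- by move=> a; exact/expectation_id/expectation_invariant.
- exact: expectation_contractive.
- move=> a /cpositive_ge0 a0; apply/cpositive_ge0 => -[d|n [d|]] //=.
  by rewrite addr_ge0// mulr_ge0// ltW// ofR_gt0 ?weight_gt0 ?weight_lt1.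
- move=> b a /C0_imageP bi; apply: CbP => -[d|n [d|]] //=.
    by rewrite (bi None d : (b : CK) (Apex d) = _).
  have be e :
      (b : CK) (Point n (Some e)) = (b : CK) (Point n (Some false)).
    exact: (bi (Some n) e).
  by rewrite !be; ring.
- move=> a b /C0_imageP bi; apply: CbP => -[d|n [d|]] //=.
    by rewrite (bi None d : (b : CK) (Apex d) = _).
  have be e :
      (b : CK) (Point n (Some e)) = (b : CK) (Point n (Some false)).
    exact: (bi (Some n) e).
  by rewrite !be; ring.
Qed.

(** All weights at isolated points are positive, so the function vanishes there,
    and the isolated points are dense in the spectrum. *)
Lemma expectation_faithful : faithful expectation.
Proof.
move=> a Ea.
have Ea0 k : (expectation (cmul (cstar a) a) : CK) k = 0 by rewrite Ea.
pose q k := ((a : CK) k)^* * (a : CK) k.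
have q_ge0 k : 0 <= q k by rewrite /q mulrC -normCK exprn_ge0.
have q0 k : q k = 0 -> (a : CK) k = 0.
  by rewrite /q mulrC -normCK => /eqP; rewrite expf_eq0 /= normr_eq0 => /eqP.
have aPoint n s : (a : CK) (Point n s) = 0.
  apply: q0; case: s => [b|]; last exact: (Ea0 (Point n None)).
  have : ofR (1 - weight n) * q (Point n (Some false)) +
      ofR (weight n) * q (Point n (Some true)) = 0 := Ea0 (Point n (Some b)).
  have w0 := ofR_gt0 (weight_gt0 n); have w1 := ofR_gt0 (weight_lt1 n).
  have wq_ge0 r k : 0 < ofR r -> 0 <= ofR r * q k.
    by move=> /ltW r0; exact: mulr_ge0.
  move/eqP; rewrite (paddr_eq0 (wq_ge0 _ _ w1) (wq_ge0 _ _ w0)).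
  rewrite (mulf_eq0 (ofR (1 - weight n))) (mulf_eq0 (ofR (weight n))).
  rewrite (gt_eqF w0) (gt_eqF w1) /= => /andP[/eqP q00 /eqP q10].
  by case: b.
apply: CbP => -[b|n s]; last exact: aPoint.
have ab : (a : CK) (Point n (Some b)) @[n --> \oo] --> (a : CK) (Apex b).
  exact: Cb_spectrum_cvg.
apply: (cvg_unique (@norm_hausdorff _ _) ab).
by apply: cvg_near_cst; apply: nearW => n; exact: aPoint.
Qed.

End reduced_algebra.

Theorem proposition5p3 (R : realType) :
  exists G : topological_groupoid,
    etale G /\ ~ hausdorff_space G /\
    exists (A : cstar_algebra R) (iota : (G -> CC R) -> A),
      is_reduced_cstar_algebra iota /\
      exists E : A -> A,
        is_conditional_expectation (C0_image iota) E /\ faithful E.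
Proof.
exists branched_groupoid; split; first exact: branched_groupoid_etale.
split; first exact: arrow_not_hausdorff.
exists (Cb_cstar R spectrum), (@Cc_embedding R).
split; first exact: Cc_embedding_reduced.
exists (@expectation R); split; first exact: expectation_conditional.
exact: expectation_faithful.
Qed.
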